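(* For every $n\in\mathbb{N}$, the expected value of the random variable $L_n=L_n(\sigma)$ on $(S_n,P_n)$ satisfies $$E_nL_n=\frac1{n!}\sum_{\sigma\in S_n}L_n(\sigma)=\frac{(n+1)^{n-1}}{n!},$$ and $$E_nL_n\sim\frac{e^{n+1}}{\sqrt{2\pi}\,n^{3/2}}\quad\text{as }n\to\infty.$$
   Context: $[n]=\{1,\dots,n\}$; $S_n$ is the set of permutations $\sigma=\sigma_1\cdots\sigma_n$ of $[n]$; $P_n$ is the uniform probability measure on $S_n$ and $E_n$ the corresponding expectation. For $1\le i\le n$ and $\sigma\in S_n$, $l_{n,i}(\sigma)=\max\{l\in[i]:\ \sigma_i=\max(\sigma_i,\sigma_{i-1},\dots,\sigma_{i-l+1})\}$, and $L_n(\sigma)=\prod_{i=1}^n l_{n,i}(\sigma)$. $a_n\sim b_n$ means $a_n/b_n\to1$. *)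

(* Defs.v *)
From HB Require Import structures.
From mathcomp Require Import all_boot all_order all_algebra all_fingroup.
From mathcomp Require Import all_classical all_reals all_analysis.

Set Implicit Arguments.
Unset Strict Implicit.
Unset Printing Implicit Defensive.

Import Order.TTheory GRing.Theory Num.Theory numFieldNormedType.Exports.

Local Open Scope classical_set_scope.
Local Open Scope ring_scope.

HB.instance Definition _ (T : finType) :=
  isPointed.Build (perm_type T) (1%g : {perm T}).

HB.instance Definition _ (T : finType) :=
  @isMeasurable.Build default_measure_display (perm_type T)
    discrete_measurable discrete_measurable0
    discrete_measurableC discrete_measurableU.

(* Positions and values are numbered from 0: [s i] stands for sigma_(i+1) - 1.
   So [l] ranges over {1, ..., i+1}, and the entries sigma_(i+1), sigma_i, ...,
   sigma_(i+1-l+1) are those at the 0-based positions j with i+1-l <= j <= i.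
   The value l = 1 always qualifies, so the outer maximum is never the
   default 0 of the empty maximum. *)
Definition left_run (n : nat) (s : 'S_n) (i : 'I_n) : nat :=
  (\max_(1 <= l < i.+2 |
      (s i == \max_(j < n | i.+1 - l <= j <= i) s j :> nat)) l)%N.

Definition left_run_prod (R : realType) (n : nat) (s : 'S_n) : R :=
  (\prod_(i < n) left_run s i)%:R.

HB.instance Definition _ (R : realType) (n : nat) :=
  @isMeasurableFun.Build _ _ {perm 'I_n} R (@left_run_prod R n)
    (fun _ _ _ => I).

Definition uniform_perm (R : realType) (n : nat) (A : set 'S_n) : \bar R :=
  (#|[set s : 'S_n | s \in A]%SET|%:R / n`!%:R)%:E.

Section uniform_perm.
Variables (R : realType) (n : nat).

Let diracs : set 'S_n -> \bar R :=
  mscale (n`!%:R^-1)%:nng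
    (msum (fun k => dirac (nth (1%g : 'S_n) (enum 'S_n) k)) n`!).

Let uniform_permE : @uniform_perm R n = diracs.
Proof.
apply/funext => A; rewrite /uniform_perm /diracs /mscale /= mulrC EFinM.
congr (_ * _)%E.
rewrite /msum /= /dirac/= /indic sumEFin; congr (_%:E).
have sz : size (enum 'S_n) = n`! by rewrite -cardE card_Sn.
rewrite -[in RHS]sz -(big_mkord xpredT
  (fun k => (nth (1%g : 'S_n) (enum 'S_n) k \in A)%:R : R)).
rewrite -(big_nth (1%g : 'S_n) xpredT (fun s => (s \in A)%:R : R)).
rewrite big_enum /= -natr_sum -big_mkcond sum1_card; congr _%:R.
by apply: eq_card => s; rewrite !inE.
Qed.

Let uniform_perm0 : @uniform_perm R n set0 = 0%E.
Proof. by rewrite uniform_permE /diracs measure0. Qed.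

Let uniform_perm_ge0 A : (0 <= @uniform_perm R n A)%E.
Proof. by rewrite uniform_permE /diracs measure_ge0. Qed.

Let uniform_perm_sigma_additive : semi_sigma_additive (@uniform_perm R n).
Proof. by rewrite uniform_permE /diracs; exact: measure_semi_sigma_additive. Qed.

HB.instance Definition _ := isMeasure.Build _ _ _ (@uniform_perm R n)
  uniform_perm0 uniform_perm_ge0 uniform_perm_sigma_additive.

Let uniform_permT : @uniform_perm R n setT = 1%E.
Proof.
rewrite /uniform_perm (_ : [set s | _]%SET = [set: 'S_n]%SET); last first.
  by apply/setP => s; rewrite !inE; apply/mem_set.
by rewrite cardsT card_Sn divff// pnatr_eq0 -lt0n fact_gt0.
Qed.

HB.instance Definition _ := Measure_isProbability.Build _ _ _
  (@uniform_perm R n) uniform_permT.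

End uniform_perm.

Definition asymp_equiv (R : realType) (a b : R^nat) : Prop :=
  (a n / b n) @[n --> \oo] --> (1 : R).

Arguments left_run_prod R {n} s.
Arguments uniform_perm R n A : clear implicits.

(* Main.v *)
Require Import Defs.
From mathcomp Require Import all_boot all_order all_algebra all_fingroup.
From mathcomp Require Import all_classical all_reals all_analysis.
From mathcomp Require Import measurable_realfun.
From mathcomp Require Import zify ring lra.

(** The product of the left runs of a permutation counts the parking functions
with that outcome, and the exact formula is proved by Pollak's circle argument
for parking functions, phrased for permutations. Put the [n.+1] positions on a
circle, give position [j] a weight [x j], and let the weight of a permutation
[s] of the circle be the product, over all positions except that of the
maximum, of the total weight of the circular run ending there. The sum of
these weights over all [s] is [(\sum_j x j) ^ n] ([sum_arc_weight]). Indeed the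
minimum of [s] has a run reduced to itself and blocks no other run: deleting it
from position [i] takes out a factor [x i] and, if [x i] is added to the weight
of the next position, changes no other run weight. As this merging preserves
the total weight, induction applies. For [x = 1] the sum is [n.+1 ^ n]. The
weights are invariant under rotations, so each of the [n.+1] positions of the
maximum contributes the same amount. When the maximum is at position 0, no run
crosses it, the circle is cut into a line there, and the weight becomes the
product of the left runs of the remaining permutation of [n] letters. Dividing
by [n.+1] gives [n.+1 ^ n.-1] ([sum_left_run_prod]).

The asymptotics is Stirling's formula. Two elementary bounds on [ln v] for
[1 <= v], each with an error of third order at [v = 1], show that the logarithm
of [n! e^n / n^(n + 1/2)] decreases, by at most a telescoping amount at each
step, so that this ratio has a positive limit [a].
The integrals of [sin ^+ n] over [[0, pi / 2]] (Wallis) identify it: they give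
the central binomial coefficient up to an explicit factor, and their recurrence
and monotonicity yield its size, hence the limit of the quotient
[stirling_ratio (2 n) / stirling_ratio n ^ 2], which is also [1 / a]. This
forces [a = sqrt (2 pi)] ([cvg_stirling_ratio]). The expectation divided by its
claimed equivalent is a product of
[sqrt (2 pi) / stirling_ratio n], [(1 + 1/n) ^ n / e] and [n / (n + 1)], each of
limit 1. *)

Set Implicit Arguments.
Unset Strict Implicit.
Unset Printing Implicit Defensive.

Import Order.TTheory GRing.Theory Num.Theory numFieldNormedType.Exports.

(** * Decomposing sums over permutations *)

Section PermLift.
Local Open Scope nat_scope.

Lemma big_perm_lift (R : Type) (idx : R) (op : Monoid.com_law idx) n
    (j : 'I_n.+1) (F : 'S_n.+1 -> R) :
  \big[op/idx]_s F s =
  \big[op/idx]_(i < n.+1) \big[op/idx]_(t : 'S_n) F (lift_perm i j t).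
Proof.
pose h (p : 'I_n.+1 * 'S_n) := lift_perm p.1 j p.2.
have h_inj : injective h.
  move=> [i1 t1] [i2 t2]; rewrite /h /= => eq_h.
  have eq_i : i1 = i2.
    by apply: (@perm_inj _ (lift_perm i1 j t1)); rewrite {2}eq_h !lift_perm_id.
  rewrite -{}eq_i in eq_h *; congr pair; apply/permP => m.
  by apply: (@lift_inj _ j); rewrite -!(lift_perm_lift i1) eq_h.
have h_bij : bijective h.
  by apply: inj_card_bij => //; rewrite card_prod card_ord !card_Sn.
by rewrite (reindex h) ?pair_bigA //; exact: onW_bij.
Qed.

Lemma big_perm_fix (R : Type) (idx : R) (op : Monoid.com_law idx) n
    (i j : 'I_n.+1) (F : 'S_n.+1 -> R) :
  \big[op/idx]_(s : 'S_n.+1 | s i == j) F s =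
  \big[op/idx]_(t : 'S_n) F (lift_perm i j t).
Proof.
rewrite big_mkcond (big_perm_lift _ j) (bigD1 i) //= [X in op _ X]big1.
  by rewrite Monoid.mulm1; apply: eq_bigr => t _; rewrite lift_perm_id eqxx.
move=> i' ne_i; apply: big1 => t _; case: eqP => // eq_j; case/eqP: ne_i.
by apply: (@perm_inj _ (lift_perm i' j t)); rewrite lift_perm_id.
Qed.

End PermLift.

(** * Weighted runs on a circle *)

Section CircularRuns.
Local Open Scope nat_scope.
Local Open Scope set_scope.

(** Walking rightwards on the circle from [j] to its first visit of [i], one
meets [k]; the three cases say where the walk wraps around, if it does. *)
Definition on_arc (j k i : nat) : bool :=
  [|| j <= k <= i, i < j <= k | k <= i < j].

Definition arc_run n (s : 'S_n) (i : 'I_n) : {set 'I_n} :=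
  [set j : 'I_n | [forall k : 'I_n, on_arc j k i ==> (s k <= s i)]].

(** The position of the maximum is left out of the product: it becomes the
point where the circle is cut. *)
Definition arc_weight n (x : 'I_n -> nat) (s : 'S_n) : nat :=
  \prod_(i < n | (s i).+1 != n) \sum_(j in arc_run s i) x j.

Section Merge.
Variables (n : nat) (x : 'I_n.+2 -> nat) (i : 'I_n.+2).

(** The position following [i] on the circle, numbered as in the circle without
[i]: the modulus makes the successor of the last position 0. *)
Definition merge_pos : 'I_n.+1 := inord (i %% n.+1).
Definition merge (m : 'I_n.+1) : nat := x (lift i m) + (m == merge_pos) * x i.

Lemma sum_merge : \sum_m merge m = \sum_j x j.
Proof.
rewrite big_split /= [RHS](bigD1_ord i) //= addnC; congr addn.
rewrite (bigD1 merge_pos) //= eqxx mul1n big1 ?addn0 // => m /negPf ->.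
by rewrite mul0n.
Qed.

Lemma val_merge_pos : merge_pos = (if i == ord_max then 0 else i) :> nat.
Proof.
rewrite /merge_pos inordK ?ltn_mod //; case: eqP => [->|ni]; first by rewrite /= modnn.
by rewrite modn_small //; have := ltn_ord i; move: ni => /eqP; rewrite -val_eqE /=; lia.
Qed.

Lemma on_arc_lift (j k m : 'I_n.+1) :
  on_arc (lift i j) (lift i k) (lift i m) = on_arc j k m.
Proof. by rewrite /on_arc /= /bump; lia. Qed.

Lemma on_arc_from (k m : 'I_n.+1) :
  on_arc i (lift i k) (lift i m) = on_arc merge_pos k m.
Proof.
rewrite /on_arc val_merge_pos -val_eqE /= /bump.
have := ltn_ord i; have := ltn_ord k; have := ltn_ord m; case: eqP; lia.
Qed.

(** The minimum blocks no run, so the other runs are unchanged except that [i]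
belongs exactly to those containing the position that follows it, which is
where [merge] has put its weight. *)
Lemma arc_run_lift_min (t : 'S_n.+1) (m : 'I_n.+1) :
  \sum_(j in arc_run (lift_perm i ord0 t) (lift i m)) x j =
  \sum_(j in arc_run t m) merge j.
Proof.
have mem_lift (j : 'I_n.+1) :
    (lift i j \in arc_run (lift_perm i ord0 t) (lift i m)) = (j \in arc_run t m).
  rewrite !inE; apply/forallP/forallP => run k.
    have := run (lift i k); rewrite on_arc_lift !lift_perm_lift /= /bump /=.
    by rewrite !add1n ltnS.
  case: (unliftP i k) => [k'|] ->; last by rewrite lift_perm_id leq0n implybT.
  by rewrite on_arc_lift !lift_perm_lift /= /bump /= !add1n ltnS; exact: run.
have mem_i :
    (i \in arc_run (lift_perm i ord0 t) (lift i m)) = (merge_pos \in arc_run t m).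
  rewrite !inE; apply/forallP/forallP => run k.
    have := run (lift i k); rewrite on_arc_from !lift_perm_lift /= /bump /=.
    by rewrite !add1n ltnS.
  case: (unliftP i k) => [k'|] ->; last by rewrite lift_perm_id leq0n implybT.
  by rewrite on_arc_from !lift_perm_lift /= /bump /= !add1n ltnS; exact: run.
rewrite big_mkcond (bigD1_ord i) //= mem_i [RHS]big_split /= addnC; congr addn.
  by rewrite [RHS]big_mkcond; apply: eq_bigr => j _; rewrite mem_lift.
rewrite big_mkcond (bigD1 merge_pos) //= eqxx mul1n big1 ?addn0 // => j /negPf ->.
by rewrite mul0n if_same.
Qed.

Lemma arc_run_min (t : 'S_n.+1) : arc_run (lift_perm i ord0 t) i = [set i].
Proof.
apply/setP => j; rewrite !inE; apply/forallP/eqP => [/(_ j)|-> k].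
  have -> : on_arc j j i by rewrite /on_arc; lia.
  rewrite lift_perm_id leqn0 => s0; apply: (@perm_inj _ (lift_perm i ord0 t)).
  by rewrite lift_perm_id; apply/val_inj/eqP.
by apply/implyP => ik; have /val_inj-> : k = i :> nat by move: ik; rewrite /on_arc; lia.
Qed.

Lemma arc_weight_lift_min (t : 'S_n.+1) :
  arc_weight x (lift_perm i ord0 t) = x i * arc_weight merge t.
Proof.
rewrite /arc_weight (bigD1_ord i) /= ?lift_perm_id //.
rewrite arc_run_min big_set1; congr muln.
by apply: eq_big => [m|m _]; rewrite ?lift_perm_lift ?arc_run_lift_min.
Qed.

End Merge.

(** Induction on [n], removing the minimum. The total weight is preserved by
[merge], and the removed factors [x i] add up to one more copy of it. *)
Lemma sum_arc_weight n (x : 'I_n.+1 -> nat) :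
  \sum_(s : 'S_n.+1) arc_weight x s = (\sum_i x i) ^ n.
Proof.
elim: n x => [|n IHn] x.
  rewrite expn0 -[RHS]/(1`!) -card_Sn -sum1_card; apply: eq_bigr => s _.
  by rewrite /arc_weight big1 // => i; rewrite (ord1 (s i)).
rewrite (big_perm_lift _ ord0) expnS big_distrl /=; apply: eq_bigr => i _.
rewrite -(sum_merge x i) -IHn big_distrr; apply: eq_bigr => t _.
exact: arc_weight_lift_min.
Qed.

Lemma on_arc_shift n (e j k i : 'I_n.+1) :
  on_arc (j + e)%R (k + e)%R (i + e)%R = on_arc j k i.
Proof.
have val_add (a : 'I_n.+1) :
    ((a + e)%R = a + e :> nat /\ a + e < n.+1) \/
    ((a + e)%R + n.+1 = a + e /\ n < a + e).
  rewrite /=; case: (ltnP (a + e) n.+1) => [lt|le]; first by left; rewrite modn_small.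
  right; rewrite -[in (_ %% _)](subnK le) modnDr modn_small ?subnK //.
  by have := ltn_ord a; have := ltn_ord e; lia.
have := ltn_ord j; have := ltn_ord k; have := ltn_ord i.
move: (val_add j) (val_add k) (val_add i); rewrite /on_arc.
by do 3!(case=> -[]) ; lia.
Qed.

Definition shift_perm n (e : 'I_n.+1) : 'S_n.+1 := perm (@addIr 'I_n.+1 e).

Lemma arc_weight_shift n (e : 'I_n.+1) (s : 'S_n.+1) :
  arc_weight (fun=> 1) (shift_perm e * s) = arc_weight (fun=> 1) s.
Proof.
rewrite /arc_weight [RHS](reindex_inj (@addIr _ e)) /=.
apply: eq_big => [i|i _]; first by rewrite permM permE.
rewrite [RHS](reindex_inj (@addIr _ e)) /=; apply: eq_bigl => j.
rewrite !inE; apply/forallP/forallP => run k.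
  by have := run (k - e)%R; rewrite !permM !permE -(on_arc_shift e j) subrK.
by have := run (k + e)%R; rewrite on_arc_shift !permM !permE.
Qed.

Lemma sum_arc_weight_max n (e : 'I_n.+1) :
  \sum_(t : 'S_n) arc_weight (fun=> 1) (lift_perm e ord_max t) =
  \sum_(t : 'S_n) arc_weight (fun=> 1) (lift_perm ord0 ord_max t).
Proof.
rewrite -!big_perm_fix [RHS](reindex_inj (mulgI (shift_perm e))) /=.
by apply: eq_big => [s|s _]; rewrite ?arc_weight_shift // permM permE add0r.
Qed.

End CircularRuns.

(** * The sum of the products of left runs *)

Section LeftRuns.
Local Open Scope nat_scope.
Local Open Scope set_scope.

Lemma card_ord_itv n (a : nat) (i : 'I_n) :
  #|[set j : 'I_n | a <= j <= i]| = i.+1 - a.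
Proof.
rewrite -sum1_card -[RHS]muln1 -sum_nat_const_nat.
rewrite (@big_nat_widenl _ _ _ a 0) // (@big_nat_widen _ _ _ 0 i.+1 n) // big_mkord.
by apply: eq_bigl => j; rewrite inE ltnS.
Qed.

(** The positions [j] from which [s i] dominates everything up to [i] form an
interval ending at [i], so the longest admissible length is their number. *)
Lemma left_run_card n (s : 'S_n) (i : 'I_n) :
  left_run s i = #|[set j : 'I_n | (j <= i) &&
                    [forall k : 'I_n, (j <= k <= i) ==> (s k <= s i)]]|.
Proof.
set J := [set _ | _].
have left_runP (l : nat) : 0 < l -> l < i.+2 ->
    (s i == \max_(j < n | i.+1 - l <= j <= i) s j :> nat) =
    [forall k : 'I_n, (i.+1 - l <= k <= i) ==> (s k <= s i)].
  move=> l_gt0 l_le; rewrite eqn_leq (bigop.bigmax_sup i) /=; last by []; last by lia.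
  by apply/bigop.bigmax_leqP/forallP => H k; [apply/implyP; exact: H | exact/implyP].
rewrite /left_run; apply/eqP; rewrite eqn_leq; apply/andP; split.
  rewrite big_nat_cond; apply/bigop.bigmax_leqP_seq => l _ /andP[/andP[l_gt0 l_le]].
  rewrite left_runP // => /forallP run.
  have -> : l = #|[set j : 'I_n | i.+1 - l <= j <= i]| by rewrite card_ord_itv; lia.
  apply/subset_leq_card/fintype.subsetP => j; rewrite !inE => /andP[lj ji]; rewrite ji.
  apply/forallP => k; apply/implyP => /andP[jk ki]; apply: (implyP (run k)).
  by rewrite ki (leq_trans lj jk).
have iJ : i \in J.
  rewrite inE leqnn; apply/forallP => k; apply/implyP => ik.
  by have /val_inj-> : k = i :> nat by lia.
case: (arg_minnP (fun j : 'I_n => j : nat) iJ) => j0 j0J j0_min.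
have := j0J; rewrite -[is_true _]/(is_true (j0 \in J)) inE => /andP[j0i run].
apply: (@leq_trans (i.+1 - j0)).
  rewrite -(card_ord_itv j0); apply/subset_leq_card/fintype.subsetP => j jJ.
  by rewrite inE j0_min //=; move: jJ; rewrite inE => /andP[].
apply: bigop.bigmaxn_sup_seq (leqnn _); first by rewrite mem_index_iota; lia.
by rewrite left_runP ?subKn //; lia.
Qed.

(** The maximum at position 0 blocks every run that would wrap around. *)
Lemma arc_weight_lift_max n (t : 'S_n) :
  arc_weight (fun=> 1) (lift_perm ord0 ord_max t) = \prod_(i < n) left_run t i.
Proof.
rewrite /arc_weight big_mkcond (bigD1_ord ord0) //= lift_perm_id eqxx /= mul1n.
apply: eq_bigr => m _; rewrite lift_perm_lift lift_max.
rewrite eqSS ltn_eqF // left_run_card sum1_card /=.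
rewrite -[RHS](card_imset _ (@lift_inj _ ord0)); apply: eq_card => j.
have not_run (k : 'I_n.+1) : on_arc k 0 (lift ord0 m) ->
    k \notin arc_run (lift_perm ord0 ord_max t) (lift ord0 m).
  move=> k0; rewrite inE negb_forall; apply/existsP; exists ord0.
  by rewrite k0 /= lift_perm_id lift_perm_lift lift_max -ltnNge.
case: (unliftP ord0 j) => [j'|] ->; last first.
  rewrite (negPf (not_run _ _)) //; apply/esym/negP => /imsetP[k _ /eqP].
  by rewrite (negPf (neq_lift _ _)).
change 'I_n in j'.
rewrite (mem_imset _ _ (@lift_inj _ ord0)) [in RHS]inE.
case: (leqP j' m) => [jm|mj] /=; last first.
  by rewrite (negPf (not_run _ _)) // /on_arc /= /bump; lia.
rewrite inE; apply/forallP/forallP => run k.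
  apply/implyP => jkm; have := run (lift ord0 k).
  by rewrite !lift_perm_lift !lift_max; apply/implyP; rewrite /on_arc /= /bump; lia.
case: (unliftP ord0 k) => [k'|] ->; last by rewrite /on_arc /= /bump; lia.
change 'I_n in k'.
rewrite !lift_perm_lift !lift_max; apply/implyP => jkm; apply: (implyP (run k')).
by move: jkm; rewrite /on_arc /= /bump; lia.
Qed.

(** Both counts of the circular weights: the total is [n.+1 ^ n], and each of
the [n.+1] positions of the maximum gives the sum on the left. *)
Lemma sum_left_run_prod n :
  \sum_(t : 'S_n) \prod_(i < n) left_run t i = n.+1 ^ n.-1.
Proof.
have : \sum_(s : 'S_n.+1) arc_weight (fun=> 1) s = n.+1 ^ n.
  by rewrite sum_arc_weight sum1_card card_ord.
rewrite (big_perm_lift _ ord_max).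
under eq_bigr do rewrite sum_arc_weight_max.
rewrite sum_nat_const card_ord.
under eq_bigr do rewrite arc_weight_lift_max.
case: n => [|n]; first by rewrite !mul1n.
by rewrite expnS => /eqP; rewrite eqn_pmul2l // => /eqP.
Qed.

End LeftRuns.

Local Open Scope classical_set_scope.
Local Open Scope ring_scope.

(** * Expectation under the uniform measure *)

(** Writing the uniform measure as a scaled finite sum of Dirac masses makes its
integrals computable. *)
Lemma uniform_perm_dirac (R : realType) (n : nat) (A : set 'S_n) :
  uniform_perm R n A =
  mscale (n`!%:R^-1)%:nng
    (msum (fun k => dirac (nth (1%g : 'S_n) (enum 'S_n) k)) n`!) A.
Proof.
have sz : size (enum 'S_n) = n`! by rewrite -cardE card_Sn.
rewrite /uniform_perm /mscale /= mulrC EFinM; congr (_ * _)%E.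
rewrite /msum /= /dirac /= /indic sumEFin; congr (_%:E); rewrite -[in RHS]sz.
rewrite -(big_mkord xpredT
  (fun k => (nth (1%g : 'S_n) (enum 'S_n) k \in A)%:R : R)).
rewrite -(big_nth (1%g : 'S_n) xpredT (fun s => (s \in A)%:R : R)).
rewrite big_enum /= -natr_sum -big_mkcond sum1_card; congr _%:R.
by apply: eq_card => s; rewrite !inE.
Qed.

Lemma expectation_uniform_perm (R : realType) (n : nat) :
  ('E_(uniform_perm R n)[left_run_prod R])%E =
  ((n`!%:R)^-1 * \sum_(s : 'S_n) left_run_prod R s)%:E.
Proof.
have sz : size (enum 'S_n) = n`! by rewrite -cardE card_Sn.
have X_ge0 (s : 'S_n) : (0 <= (left_run_prod R s)%:E)%E.
  by rewrite lee_fin ler0n.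
have mX : measurable_fun setT (EFin \o left_run_prod R (n := n)) by [].
rewrite unlock (@eq_measure_integral _ _ _ _
  (mscale (n`!%:R^-1)%:nng
    (msum (fun k => dirac (nth (1%g : 'S_n) (enum 'S_n) k)) n`!))); last first.
  by move=> A _ _; exact: uniform_perm_dirac.
rewrite ge0_integral_mscale //= ge0_integral_measure_sum //.
under eq_bigr do rewrite integral_dirac // diracT mul1e.
rewrite sumEFin -EFinM -[in LHS]sz.
rewrite -(big_mkord xpredT (fun k => left_run_prod R (nth (1%g : 'S_n) (enum 'S_n) k))) -(big_nth _ xpredT) big_enum /= sz.
by congr (_ * _)%:E; apply: eq_bigl => s; rewrite inE.
Qed.

(** * Third-order bounds on the logarithm *)

Section LnBounds.
Context {R : realType}.
Implicit Types (f df : R -> R) (a t v : R).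

Lemma is_derive_ge0_le f df a t :
  (forall u : R, a <= u -> is_derive u (1 : R) f (df u)) ->
  (forall u : R, a <= u -> 0 <= df u) -> a <= t -> f a <= f t.
Proof.
move=> dfE df_ge0 at_; rewrite -subr_ge0.
have [||c] := @MVT_segment R f df a t at_.
- by move=> u; rewrite in_itv /= => /andP[/ltW au _]; exact: dfE.
- apply: derivable_within_continuous => u; rewrite in_itv /= => /andP[au _].
  by apply: ex_derive; exact: dfE.
rewrite in_itv /= => /andP[ac _] ->.
by rewrite mulr_ge0 ?df_ge0 ?subr_ge0.
Qed.

Lemma ln_le_subr1 v : 0 < v -> ln v <= v - 1.
Proof. by move=> v0; rewrite -{1}[v](subrK 1) addrC le_ln1Dx //; lra. Qed.

(** The derivative of the difference of the two sides is [ln v - (1 - v^-1)],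
nonnegative by [ln_le_subr1] at [v^-1]. *)
Lemma ln_ge_pade v : 1 <= v -> 2 * (v - 1) <= (v + 1) * ln v.
Proof.
move=> v1; rewrite -subr_ge0.
pose f : R -> R := (id + cst 1) * (@ln R) - (2 : R) \*: (id - cst 1).
have f1 : f 1 = 0 by rewrite /f !fctE /= ln1 subrr mulr0 scaler0 subr0.
rewrite -[leLHS]f1 -[leRHS]/(f v).
apply: (@is_derive_ge0_le f (fun u => ln u - (1 - u^-1)) 1 v _ _ v1) => u u1.
- have u_gt0 : 0 < u by lra.
  have dln := is_derive1_ln u_gt0.
  rewrite /f; apply: is_derive_eq; rewrite /= /GRing.scale /=.
  rewrite -[(id + cst 1) u]/(u + 1); field; lra.
- have u_gt0 : 0 < u by lra.
  have := @ln_le_subr1 u^-1; rewrite invr_gt0 lnV ?posrE //.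
  by move=> /(_ u_gt0); lra.
Qed.

(** The derivative of the difference of the two sides is [2 (v - 1 - ln v)]. *)
Lemma ln_le_trapezoid v : 1 <= v -> 2 * v * ln v <= v ^+ 2 - 1.
Proof.
move=> v1; rewrite -subr_ge0.
pose f : R -> R := (id ^+ 2 - cst 1) - ((2 : R) \*: id) * (@ln R).
have f1 : f 1 = 0 by rewrite /f !fctE /= ln1 mulr0 expr1n subrr subr0.
rewrite -[leLHS]f1 -[leRHS]/(f v).
apply: (@is_derive_ge0_le f (fun u => 2 * (u - 1 - ln u)) 1 v _ _ v1) => u u1.
- have u_gt0 : 0 < u by lra.
  have dln := is_derive1_ln u_gt0.
  rewrite /f; apply: is_derive_eq; rewrite /= /GRing.scale /=.
  rewrite expr1; field; lra.
- have u_gt0 : 0 < u by lra.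
  by have := @ln_le_subr1 u u_gt0; lra.
Qed.
End LnBounds.

(** * Wallis integrals *)

Section Wallis.
Context {R : realType}.
Notation mu := (@lebesgue_measure R).

Definition wallis (n : nat) : R :=
  (\int[mu]_(x in `[0, pi / 2]) (sin x ^+ n))%R.

Let pih_gt0 : 0 < pi / 2 :> R.
Proof. by rewrite divr_gt0 ?pi_gt0. Qed.

Let continuous_sinX n : continuous (fun x : R => sin x ^+ n).
Proof.
move=> x; apply: (@continuous_comp _ _ _ sin (fun y => y ^+ n)).
  exact: continuous_sin.
exact: exprn_continuous.
Qed.

Let integrable_continuous (f : R -> R) :
  continuous f -> mu.-integrable `[0, pi / 2] (EFin \o f).
Proof.
move=> cf; apply: continuous_compact_integrable; first exact: segment_compact.
exact: continuous_subspaceT.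
Qed.

Let sin_itv (x : R) : x \in `[0, pi / 2] -> 0 <= sin x <= 1.
Proof.
rewrite in_itv /= => /andP[x0 x1]; rewrite sin_le1 andbT sin_ge0_pi // x0 /=.
by rewrite (le_trans x1) // ler_pdivrMr // ler_peMr ?pi_ge0 // ler1n.
Qed.

Lemma wallis_nincr n : wallis n.+1 <= wallis n.
Proof.
apply: le_Rintegral => //; 
  try (by apply: integrable_continuous; exact: continuous_sinX).
by move=> x /sin_itv /andP[s0 s1]; rewrite exprS ler_piMl // exprn_ge0.
Qed.

Lemma wallis0 : wallis 0 = pi / 2.
Proof.
rewrite /wallis; under eq_Rintegral do rewrite expr0.
by rewrite Rintegral_cst //= lebesgue_measure_itv /= lte_fin pih_gt0 /= mul1r subr0.
Qed.

Lemma wallis_FTC (F f : R -> R) :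
  continuous f -> (forall x, is_derive x (1 : R) F (f x)) ->
  (\int[mu]_(x in `[0, pi / 2]) f x)%R = F (pi / 2) - F 0.
Proof.
move=> cf dF.
have cF x : F y @[y --> x] --> F x.
  apply: differentiable_continuous; apply/derivable1_diffP.
  by apply: ex_derive; exact: dF.
rewrite /Rintegral (@continuous_FTC2 _ f F) //.
- exact: continuous_subspaceT.
- split; first by move=> x _; apply: ex_derive; exact: dF.
  + by apply: cvg_at_right_filter; exact: cF.
  + by apply: cvg_at_left_filter; exact: cF.
- by move=> x _; rewrite derive1E; apply: derive_val; exact: dF.
Qed.

Lemma wallis1 : wallis 1 = 1.
Proof.
rewrite /wallis; under eq_Rintegral do rewrite expr1.
have dF (x : R) : is_derive x (1 : R) (- cos : R -> R) (sin x).
  by apply: is_derive_eq; rewrite opprK.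
by rewrite (wallis_FTC (@continuous_sin R) dF) !fctE cos_pihalf cos0; ring.
Qed.

(** The integrand of the difference of the two sides is the derivative of
[- cos x * sin x ^+ n.+1], which vanishes at 0 and at [pi / 2]. *)
Lemma wallisSS n : n.+2%:R * wallis n.+2 = n.+1%:R * wallis n.
Proof.
have cZ (c : R) m : continuous (fun x : R => c * sin x ^+ m).
  by move=> x; apply: cvgM; [exact: cvg_cst | exact: continuous_sinX].
pose f (x : R) := n.+2%:R * sin x ^+ n.+2 - n.+1%:R * sin x ^+ n.
have cf : continuous f by move=> x; apply: cvgB; exact: cZ.
have dF (x : R) : is_derive x (1 : R) (- (cos * sin ^+ n.+1) : R -> R) (f x).
  apply: is_derive_eq; rewrite /GRing.scale /= /f.
  have -> : cos x * (n.+1%:R * sin x ^+ n * cos x) =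
            n.+1%:R * sin x ^+ n * (1 - sin x ^+ 2).
    by rewrite -cos2sin2; ring.
  rewrite exprfctE -(natr1 n.+1) !exprS; ring.
have int_sinX m : mu.-integrable `[0, pi / 2] (EFin \o (fun x => sin x ^+ m)).
  by apply: integrable_continuous; exact: continuous_sinX.
apply/eqP; rewrite -subr_eq0 -!RintegralZl //.
rewrite -RintegralB //; try (by apply: integrable_continuous; exact: cZ).
by rewrite (wallis_FTC cf dF) !fctE cos_pihalf sin0 expr0n mulr0 mul0r subrr.
Qed.

Lemma wallis_mul n : n.+1%:R * (wallis n * wallis n.+1) = pi / 2.
Proof.
elim: n => [|n IHn]; first by rewrite wallis0 wallis1 mul1r mulr1.
by rewrite mulrCA wallisSS -IHn; ring.
Qed.

Lemma wallis_gt0 n : 0 < wallis n.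
Proof.
have W_ge0 m : 0 <= wallis m.
  by apply: Rintegral_ge0 => x /sin_itv /andP[s0 _]; exact: exprn_ge0.
rewrite lt0r W_ge0 andbT; apply/eqP => W0.
by have := wallis_mul n; rewrite W0 mul0r mulr0 => /eqP; rewrite eq_sym gt_eqF.
Qed.

Lemma wallis_fact n :
  wallis (2 * n)%N * (4 ^+ n * n`!%:R ^+ 2) = pi / 2 * (2 * n)`!%:R.
Proof.
elim: n => [|n IHn]; first by rewrite muln0 wallis0 fact0 expr0 expr1n !mulr1.
rewrite (_ : 2 * n.+1 = (2 * n).+2)%N; last by rewrite mulnS.
rewrite !factS !natrM exprS.
have := wallisSS (2 * n).
have -> : (2 * n).+2%:R = 2 * n.+1%:R :> R by rewrite -natrM mulnS.
move=> WSS.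
transitivity (2 * n.+1%:R * (2 * n.+1%:R * wallis (2 * n).+2) *
    (4 ^+ n * n`!%:R ^+ 2)); first by ring.
rewrite WSS.
transitivity (2 * n.+1%:R * (2 * n).+1%:R *
    (wallis (2 * n) * (4 ^+ n * n`!%:R ^+ 2))); first by ring.
by rewrite IHn; ring.
Qed.

(** By [wallis_mul] at [2 n], [(2 n + 1) W W' = pi / 2] where [W] and [W'] are
consecutive integrals; monotonicity gives [W' <= W] and, through the recurrence,
[(2 n + 1) / (2 n + 2) * W <= W']. *)
Lemma wallis_bounds n :
  pi / 4 * (1 - (2 * n).+1%:R^-1) <= n%:R * wallis (2 * n) ^+ 2 <= pi / 4.
Proof.
set W := wallis (2 * n); set W' := wallis (2 * n).+1.
have W_gt0 : 0 < W := wallis_gt0 _.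
have W'_le : W' <= W by exact: wallis_nincr.
have W'_ge : (2 * n).+1%:R * W <= (2 * n).+2%:R * W'.
  by rewrite /W -wallisSS ler_pM2l ?wallis_nincr // ltr0n.
have := wallis_mul (2 * n); rewrite -/W -/W'.
have n_ge0 : 0 <= n%:R :> R by [].
move: W'_ge; rewrite -(natr1 (2 * n).+1) -(natr1 (2 * n)) natrM.
move: (n%:R : R) n_ge0 => x x_ge0 W'_ge WW'.
apply/andP; split.
  have -> : pi / 4 * (1 - (2 * x + 1)^-1) = x * (pi / 2) / (2 * x + 1).
    by field; lra.
  rewrite ler_pdivrMr; last lra.
  have h : 0 <= x * (2 * x + 1) * W * (W - W').
    by rewrite !mulr_ge0 ?subr_ge0 //; lra.
  by rewrite -WW'; lra.
suff : 4 * x * W ^+ 2 <= pi by lra.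
have pi2 : pi = 2 * ((2 * x + 1) * (W * W')) by lra.
rewrite pi2.
have h1 : (2 * x + 1) * W * (2 * x + 1) <= 2 * (x + 1) * W' * (2 * x + 1).
  by rewrite ler_wpM2r //; lra.
have h2 : 4 * x * W * (x + 1) <= (2 * x + 1) * W * (2 * x + 1).
  by rewrite -subr_ge0 (_ : _ - _ = W); [exact: ltW | ring].
have h3 : 4 * x * W * (x + 1) <= 2 * W' * (2 * x + 1) * (x + 1) by lra.
have h4 : 4 * x * W <= 2 * W' * (2 * x + 1).
  by rewrite ler_pM2r // in h3; lra.
have h5 : 0 <= W * (2 * W' * (2 * x + 1) - 4 * x * W).
  by rewrite mulr_ge0 ?subr_ge0 // ltW.
by lra.
Qed.

Lemma cvg_wallis : n%:R * wallis (2 * n) ^+ 2 @[n --> \oo] --> pi / 4.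
Proof.
apply: (@squeeze_cvgr _ _ _ _ (fun n => pi / 4 * (1 - (2 * n).+1%:R^-1)) (cst (pi / 4))).
- by apply: nearW => n; exact: wallis_bounds.
- have h : (2 * n).+1%:R^-1 @[n --> \oo] --> (0 : R).
    exact: (cvg_comp _ _ (@cvg_mulnl 2 isT) (@cvg_harmonic R)).
  rewrite [X in _ --> X](_ : _ = pi / 4 * (1 - 0)); last by rewrite subr0 mulr1.
  by apply: cvgM; [exact: cvg_cst | apply: cvgB; [exact: cvg_cst | exact: h]].
- exact: cvg_cst.
Qed.

End Wallis.

(** * Stirling's formula *)

Section Stirling.
Context {R : realType}.

Definition stirling_ratio (n : nat) : R :=
  n`!%:R * expR n%:R / (n%:R ^+ n * Num.sqrt n%:R).

Definition ln_stirling_ratio (n : nat) : R :=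
  ln n`!%:R - (n%:R + 2^-1) * ln n%:R + n%:R.

Lemma stirling_ratioE n :
  (0 < n)%N -> stirling_ratio n = expR (ln_stirling_ratio n).
Proof.
move=> n_gt0; have n0 : 0 < n%:R :> R by rewrite ltr0n.
rewrite /stirling_ratio /ln_stirling_ratio !expRD expRN lnK ?posrE ?ltr0n ?fact_gt0 //.
rewrite mulrAC; congr (_ / _ * _); rewrite mulrDl expRD mulr_natl -lnXn //.
rewrite lnK ?posrE ?exprn_gt0 //; congr (_ * _).
by rewrite -ln_powR lnK ?posrE ?powR_gt0 // powR12_sqrt // ltW.
Qed.

(** The step equals [(n + 1/2) ln v - 1] with [v = (n + 1) / n], to which the
two logarithm bounds apply; the upper bound telescopes. *)
Lemma ln_stirling_ratio_step n : (0 < n)%N ->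
  0 <= ln_stirling_ratio n - ln_stirling_ratio n.+1
    <= 4^-1 * (n%:R^-1 - n.+1%:R^-1).
Proof.
move=> n_gt0; have n0 : 0 < n%:R :> R by rewrite ltr0n.
pose v : R := n.+1%:R / n%:R.
have ln_v : ln v = ln n.+1%:R - ln n%:R by rewrite ln_div ?posrE ?ltr0n.
have -> : ln_stirling_ratio n - ln_stirling_ratio n.+1 = (n%:R + 2^-1) * ln v - 1.
  rewrite /ln_stirling_ratio ln_v factS natrM lnM ?posrE ?ltr0n ?fact_gt0 //.
  by rewrite -(natr1 n); lra.
have v1 : 1 <= v by rewrite ler_pdivlMr // mul1r ler_nat.
have := ln_ge_pade v1; have := ln_le_trapezoid v1.
rewrite /v -(natr1 n); move: n0 (ln _); move: (n%:R : R) => x x0 L up lo.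
apply/andP; split.
  have -> : (x + 2^-1) * L - 1 = x / 2 * (((x + 1) / x + 1) * L - 2 * ((x + 1) / x - 1)).
    by field; lra.
  by rewrite mulr_ge0 ?subr_ge0 //; lra.
rewrite -subr_ge0.
have -> : 4^-1 * (x^-1 - (x + 1)^-1) - ((x + 2^-1) * L - 1) =
  (x * (2 * x + 1)) / (4 * (x + 1)) *
    (((x + 1) / x) ^+ 2 - 1 - 2 * ((x + 1) / x) * L).
  by field; apply/andP; split; lra.
by rewrite mulr_ge0 ?subr_ge0 // divr_ge0 ?mulr_ge0 //; lra.
Qed.

(** The telescoping upper bound on the steps keeps the logarithm bounded below,
so the limit is not 0. *)
Lemma is_cvg_stirling_ratio :
  exists2 a : R, 0 < a & stirling_ratio n @[n --> \oo] --> a.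
Proof.
pose u n := ln_stirling_ratio n.+1.
have u_nincr : nonincreasing_seq u.
  apply/nonincreasing_seqP => n; rewrite -subr_ge0.
  by have /andP[] := @ln_stirling_ratio_step n.+1 isT.
have u_bound n : u 0%N - 4^-1 + 4^-1 * n.+1%:R^-1 <= u n.
  elim: n => [|n IHn]; first by rewrite invr1 mulr1 subrK.
  have /andP[_] := @ln_stirling_ratio_step n.+1 isT.
  move: IHn; rewrite /u; move: (ln_stirling_ratio _) (ln_stirling_ratio _).
  by move: (ln_stirling_ratio _) (n.+1%:R^-1) (n.+2%:R^-1) => *; lra.
have u_cvg : cvgn u.
  apply: nonincreasing_is_cvgn => //; exists (u 0%N - 4^-1) => _ [n _ <-].
  by apply: le_trans (u_bound n); rewrite lerDl mulr_ge0.
exists (expR (limn u)); first exact: expR_gt0.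
rewrite -(cvg_shiftS stirling_ratio) /=.
under eq_fun do rewrite stirling_ratioE //.
apply: (cvg_comp _ _ u_cvg).
exact: continuous_expR.
Qed.

(** The exponentials and the powers [n ^ n] cancel in the quotient, leaving, up to
an explicit factor, the central binomial coefficient, which [wallis_fact] expresses by a Wallis integral. *)
Lemma stirling_ratio_wallis n : (0 < n)%N ->
  (stirling_ratio (2 * n) / stirling_ratio n ^+ 2) ^+ 2 =
  2 / pi ^+ 2 * (n%:R * wallis (2 * n) ^+ 2).
Proof.
move=> n_gt0; have n0 : 0 < n%:R :> R by rewrite ltr0n.
have WE := @wallis_fact R n.
have f0 : 0 < n`!%:R :> R by rewrite ltr0n fact_gt0.
have p0 : 0 < pi :> R := pi_gt0 R.
have nn0 : 0 < n%:R ^+ n :> R by rewrite exprn_gt0.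
have e0 : 0 < expR n%:R :> R := expR_gt0 _.
have s0 : 0 < Num.sqrt n%:R :> R by rewrite sqrtr_gt0.
have -> : wallis (2 * n) = pi / 2 * (2 * n)`!%:R / (4 ^+ n * n`!%:R ^+ 2) :> R.
  by rewrite -WE mulfK // gt_eqF // mulr_gt0 ?exprn_gt0.
have s2 : Num.sqrt 2 ^+ 2 = 2 :> R by rewrite sqr_sqrtr.
have sn2 : Num.sqrt n%:R ^+ 2 = n%:R :> R by rewrite sqr_sqrtr // ltW.
have nE : (2 * n)%N%:R ^+ (2 * n)%N = 4 ^+ n * (n%:R ^+ n) ^+ 2 :> R.
  by rewrite natrM exprMn exprM -[2 ^+ 2]natrX mulnC exprM.
have eE : expR (2 * n)%:R = expR n%:R ^+ 2 :> R.
  by rewrite natrM expRM_natl.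
have sE : Num.sqrt (2 * n)%:R = Num.sqrt 2 * Num.sqrt n%:R :> R.
  by rewrite natrM sqrtrM.
rewrite /stirling_ratio nE eE sE.
have -> : ((2 * n)`!%:R * expR n%:R ^+ 2 /
    (4 ^+ n * (n%:R ^+ n) ^+ 2 * (Num.sqrt 2 * Num.sqrt n%:R)) /
    (n`!%:R * expR n%:R / (n%:R ^+ n * Num.sqrt n%:R)) ^+ 2) ^+ 2 =
  ((2 * n)`!%:R / (4 ^+ n * n`!%:R ^+ 2)) ^+ 2 * (Num.sqrt n%:R ^+ 2) / (Num.sqrt 2 ^+ 2) :> R.
  by field; rewrite !gt_eqF.
have q0 : 0 < 4 ^+ n :> R by rewrite exprn_gt0.
rewrite s2 sn2; move: (n`!%:R : R) (4 ^+ n : R) (pi : R) f0 q0 p0 => f q p f0 q0 p0.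
by field; rewrite !gt_eqF.
Qed.

Lemma cvg_sqr (u : R^nat) (l : R) :
  u n @[n --> \oo] --> l -> u n ^+ 2 @[n --> \oo] --> l ^+ 2.
Proof.
by move=> ul; under eq_fun do rewrite expr2; rewrite expr2; exact: cvgM.
Qed.

(** A positive limit [a] satisfies [(a / a ^+ 2) ^+ 2 = 1 / (2 pi)], by passing
to the limit in [stirling_ratio_wallis]. *)
Lemma cvg_stirling_ratio : stirling_ratio n @[n --> \oo] --> Num.sqrt (2 * pi).
Proof.
have [a a_gt0 cvg_a] := is_cvg_stirling_ratio.
have cvg_a2 : stirling_ratio (2 * n) @[n --> \oo] --> a.
  exact: (cvg_comp _ _ (@cvg_mulnl 2 isT) cvg_a).
have p0 : 0 < pi :> R := pi_gt0 R.
have cvg_l : (stirling_ratio (2 * n) / stirling_ratio n ^+ 2) ^+ 2 @[n --> \oo]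
    --> (a / a ^+ 2) ^+ 2.
  apply: (@cvg_sqr (fun n => stirling_ratio (2 * n) / stirling_ratio n ^+ 2)).
  apply: cvgM => //; apply: cvgV; first by rewrite expf_neq0 ?gt_eqF.
  exact: cvg_sqr.
have cvg_r : (stirling_ratio (2 * n) / stirling_ratio n ^+ 2) ^+ 2 @[n --> \oo]
    --> 2 / pi ^+ 2 * (pi / 4).
  have h : 2 / pi ^+ 2 * (n%:R * wallis (2 * n) ^+ 2) @[n --> \oo]
      --> 2 / pi ^+ 2 * (pi / 4 : R).
    by apply: cvgM; [exact: cvg_cst | exact: cvg_wallis].
  apply: cvg_trans h; apply: near_eq_cvg; near=> n.
  by rewrite stirling_ratio_wallis //; near: n; exact: nbhs_infty_gt.
have aE : (a / a ^+ 2) ^+ 2 = 2 / pi ^+ 2 * (pi / 4) := norm_cvg_unique cvg_l cvg_r.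
suff -> : Num.sqrt (2 * pi) = a by [].
suff -> : 2 * pi = a ^+ 2 by rewrite sqrtr_sqr gtr0_norm.
have a2E : (a / a ^+ 2) ^+ 2 = (a ^+ 2)^-1 by field; rewrite gt_eqF.
rewrite -[RHS]invrK -a2E aE; move: (pi : R) p0 => p p0; field.
by rewrite gt_eqF.
Unshelve. all: by end_near. Qed.

(** For positive [n], the exponent [n ln ((n + 1) / n)] lies between [1 - 1/n]
and 1. *)
Lemma cvg_1Dinv_expR : (n.+1%:R / n%:R) ^+ n @[n --> \oo] --> (expR 1 : R).
Proof.
rewrite -(cvg_shiftS (fun n => (n.+1%:R / n%:R) ^+ n : R)) /=.
pose v (n : nat) : R := n.+2%:R / n.+1%:R.
have vE n : (n.+2%:R / n.+1%:R) ^+ n.+1 = expR (n.+1%:R * ln (v n)).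
  by rewrite [_ * ln _]mulr_natl -lnXn ?lnK ?posrE ?exprn_gt0 ?divr_gt0.
under eq_fun do rewrite vE.
apply: (@cvg_comp _ _ _ (fun n => n.+1%:R * ln (v n)) expR _ (nbhs (1 : R))); last first.
  exact: continuous_expR.
apply: (@squeeze_cvgr _ _ _ _ (fun n => 1 - n.+1%:R^-1) (cst 1)); last 2 first.
- rewrite [X in _ --> X](_ : _ = 1 - 0); last by rewrite subr0.
  by apply: cvgB; [exact: cvg_cst | exact: cvg_harmonic].
- exact: cvg_cst.
apply: nearW => n /=.
have v_gt0 : 0 < v n by rewrite divr_gt0.
have := ln_le_subr1 v_gt0; have := @ln_le_subr1 _ (v n)^-1.
rewrite invr_gt0 => /(_ v_gt0); rewrite lnV ?posrE // /v invf_div -(natr1 n.+1).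
have : 0 < n.+1%:R :> R by [].
move: (n.+1%:R : R) (ln _) => x L x_gt0 lo up; apply/andP; split.
  apply: (@le_trans _ _ (x * (1 - x / (x + 1)))); last first.
    by rewrite ler_pM2l //; lra.
  rewrite -subr_ge0.
  have -> : x * (1 - x / (x + 1)) - (1 - x^-1) = (x * (x + 1))^-1 by field; lra.
  by rewrite invr_ge0 mulr_ge0 //; lra.
have -> : 1 = x * ((x + 1) / x - 1) :> R by field; lra.
by rewrite ler_pM2l.
Qed.

End Stirling.

(** * The expected product of left runs *)

(** Substituting [n! = stirling_ratio n * n^n * sqrt n * e^-n]. *)
Lemma ratio_stirlingE (R : realType) (n : nat) : (0 < n)%N ->
  n.+1%:R ^+ n.-1 / n`!%:R /
    (expR n.+1%:R / (Num.sqrt (2 * pi) * n%:R `^ (3 / 2))) =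
  Num.sqrt (2 * pi) / stirling_ratio n *
    ((n.+1%:R / n%:R) ^+ n / expR 1) * (1 - n.+1%:R^-1) :> R.
Proof.
case: n => // n _; rewrite /=.
have n_gt0 : 0 < n.+1%:R :> R by rewrite ltr0n.
have nX_gt0 : 0 < n.+1%:R ^+ n :> R by rewrite exprn_gt0.
have n2_gt0 : 0 < n.+2%:R :> R by rewrite ltr0n.
have f_gt0 : 0 < n.+1`!%:R :> R by rewrite ltr0n fact_gt0.
have s_gt0 : 0 < Num.sqrt n.+1%:R :> R by rewrite sqrtr_gt0.
have c_gt0 : 0 < Num.sqrt (2 * pi) :> R by rewrite sqrtr_gt0 mulr_gt0 ?pi_gt0.
have e_gt0 := expR_gt0 (n.+1%:R : R); have e1_gt0 := expR_gt0 (1 : R).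
have -> : n.+1%:R `^ (3 / 2) = n.+1%:R * Num.sqrt n.+1%:R :> R.
  rewrite (_ : 3 / 2 = 1 + 2^-1); last by field.
  by rewrite powRD ?gt_eqF ?implybT // powRr1 ?powR12_sqrt.
have -> : expR n.+2%:R = expR n.+1%:R * expR 1 :> R by rewrite -natr1 expRD.
rewrite /stirling_ratio expr_div_n !exprS.
have -> : 1 - n.+2%:R^-1 = n.+1%:R / n.+2%:R :> R.
  by rewrite -[X in _ = X / _](addrK 1) natr1 mulrBl divff ?gt_eqF // mul1r.
move: (Num.sqrt (2 * pi)) c_gt0 (Num.sqrt n.+1%:R) s_gt0 => c c_gt0 s s_gt0.
move: (expR 1) e1_gt0 (expR n.+1%:R) e_gt0 => e1 e1_gt0 e e_gt0.
move: (n.+1`!%:R : R) f_gt0 (n.+1%:R ^+ n : R) nX_gt0 => f f_gt0 nX nX_gt0.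
move: (n.+2%:R ^+ n : R) (n.+2%:R : R) n2_gt0 (n.+1%:R : R) n_gt0 => n2X n2 n2_gt0 n1 n1_gt0.
by field; rewrite !gt_eqF.
Qed.

Theorem corollary1 (R : realType) :
  (forall n : nat,
     ('E_(uniform_perm R n)[left_run_prod R])%E =
       ((n`!%:R)^-1 * \sum_(s : 'S_n) left_run_prod R s)%:E /\
     (n`!%:R)^-1 * (\sum_(s : 'S_n) left_run_prod R s) =
       n.+1%:R ^+ n.-1 / n`!%:R) /\
  asymp_equiv
    (fun n : nat => fine ('E_(uniform_perm R n)[left_run_prod R])%E)
    (fun n : nat =>
       expR n.+1%:R / (Num.sqrt (2 * pi) * n%:R `^ (3 / 2))).
Proof.
have meanE n : (n`!%:R)^-1 * (\sum_(s : 'S_n) left_run_prod R s) =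
    n.+1%:R ^+ n.-1 / n`!%:R.
  by rewrite mulrC -natr_sum sum_left_run_prod natrX.
split; first by move=> n; split; [exact: expectation_uniform_perm | exact: meanE].
rewrite /asymp_equiv.
have c_neq0 : Num.sqrt (2 * pi) != 0 :> R.
  by rewrite gt_eqF // sqrtr_gt0 mulr_gt0 ?pi_gt0.
have e_neq0 : expR 1 != 0 :> R by rewrite gt_eqF ?expR_gt0.
have cvg_s : Num.sqrt (2 * pi) / stirling_ratio n @[n --> \oo]
    --> (Num.sqrt (2 * pi) / Num.sqrt (2 * pi) : R).
  apply: cvgM; first exact: cvg_cst.
  by apply: cvgV => //; exact: cvg_stirling_ratio.
have cvg_e : (n.+1%:R / n%:R) ^+ n / expR 1 @[n --> \oo] --> (expR 1 / expR 1 : R).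
  by apply: cvgM; [exact: cvg_1Dinv_expR | exact: cvg_cst].
have cvg_n : 1 - n.+1%:R^-1 @[n --> \oo] --> (1 - 0 : R).
  by apply: cvgB; [exact: cvg_cst | exact: cvg_harmonic].
have cvg_1 : Num.sqrt (2 * pi) / stirling_ratio n *
    ((n.+1%:R / n%:R) ^+ n / expR 1) * (1 - n.+1%:R^-1) @[n --> \oo] --> (1 : R).
  rewrite [X in _ --> X](_ : 1 = Num.sqrt (2 * pi) / Num.sqrt (2 * pi) *
    (expR 1 / expR 1) * (1 - 0)); last by rewrite !divff // subr0 !mulr1.
  exact: cvgM (cvgM cvg_s cvg_e) cvg_n.
apply: cvg_trans cvg_1; apply: near_eq_cvg.
near=> n; rewrite expectation_uniform_perm /= meanE ratio_stirlingE //.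
by near: n; exact: nbhs_infty_gt.
Unshelve. all: by end_near. Qed.
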